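(* Let $r\ge 1$, let $F=\langle x_1,\ldots,x_r\rangle$ be the free group of rank $r$, let $N$ be a normal subgroup of $F$, let $N'=[N,N]$, let $B=F/N$, let $A$ be the free abelian group of rank $r$ with basis $\{a_1,\ldots,a_r\}$, and let $\phi: F/N'\hookrightarrow A\wr B$ be the Magnus embedding. Let $w$ be an element of $F/N'$ given as a word (product) in the generators $x_1,\ldots,x_r$ and their inverses. Then $$\frac{1}{2(r+1)}\,\|w\|_{F/N'}\;\le\;\|\phi(w)\|_{A\wr B}\;\le\;3\,\|w\|_{F/N'}.$$
   Context: The symbol $x_i$ also denotes the image of $x_i$ in $F/N'$ and in $B=F/N$, and $\bar{\ }$ denotes the canonical epimorphism onto $F/N$ (from $F$ or from $F/N'$), extended linearly to group rings. Wreath product: $A^{(B)}$ is the group of finitely supported functions $B\to A$ under pointwise multiplication, and $A\wr B=B\ltimes A^{(B)}$, where $b\in B$ acts on $f\in A^{(B)}$ by $f^b(x)=f(xb^{-1})$, i.e. $f^b=b^{-1}fb$ in $A\wr B$. $A$ is embedded in $A\wr B$ by identifying $a\in A$ with the function taking the value $a$ at $1_B$ and $1$ elsewhere; $B$ is embedded as the complement. For $a\in A$ and $\alpha=\sum_{b\in B}u_b b\in\mathbb{Z}[B]$, $a^{\alpha}$ denotes $\prod_{b\in B}(a^{u_b})^b\in A^{(B)}$. Magnus embedding: $\phi: F/N'\to A\wr B$ is the injective homomorphism $$\phi(g)=\overline{g}\cdot a_1^{\overline{\partial g/\partial x_1}}\cdots a_r^{\overline{\partial g/\partial x_r}},$$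 where $\partial/\partial x_i$ is the Fox derivative with respect to $x_i$, evaluated on any word in $F$ representing $g$, with $\partial x_j/\partial x_i=\delta_{ij}$ and the convention $\partial(gh)/\partial x_i=(\partial g/\partial x_i)\,h+\partial h/\partial x_i$. Equivalently, $\phi$ is the homomorphism determined by $\phi(x_i)=x_i a_i$ for $i=1,\ldots,r$. Lengths: $\|g\|_G$ is the word length of $g$ in $G$, i.e. the length of a shortest word in the generators and their inverses equal to $g$ in $G$. The generating sets are $\{x_1,\ldots,x_r\}$ for $F/N'$ and $\{x_1,\ldots,x_r\}\cup\{a_1,\ldots,a_r\}$ for $A\wr B$. *)

(* Defs.v *)
From HB Require Import structures.
From mathcomp Require Import all_boot all_order all_algebra finmap.
From mathcomp Require Import boolp classical_sets.
From mathcomp.multinomials Require Import monalg.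

Set Implicit Arguments.
Unset Strict Implicit.
Unset Printing Implicit Defensive.

Import GRing.Theory.

Local Open Scope quotient_scope.
Local Open Scope group_scope.

Section Subgroups.
Variable G : groupType.

Definition is_subgroup (H : set G) : Prop :=
  [/\ H 1, forall x y, H x -> H y -> H (x * y) & forall x, H x -> H x^-1].

Record normalSubgroup := NormalSubgroup {
  nset :> set G;
  nset_subgroup : is_subgroup nset;
  nset_conj : forall x y, nset x -> nset (x ^ y) }.

Definition commutators (H : set G) : set G :=
  [set z | exists2 x, H x & exists2 y, H y & z = [~ x, y]].

Definition derived_set (H : set G) : set G :=
  smallest is_subgroup (commutators H).

Lemma derived_subgroup (H : set G) : is_subgroup (derived_set H).
Proof.
split=> [K [[]]//|x y Hx Hy K KP|x Hx K KP].
  by case: (KP) => -[_ KM _] _; apply: KM; [apply: Hx|apply: Hy].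
by case: (KP) => -[_ _ KV] _; apply: KV; apply: Hx.
Qed.

Lemma derived_conj (N : normalSubgroup) x y :
  derived_set N x -> derived_set N (x ^ y).
Proof.
have [D1 DM DV] := derived_subgroup N.
move: x; apply: (@smallest_sub _ _ _ [set z | derived_set N (z ^ y)]).
  split=> [|u v|u] /=; first by rewrite conj1g.
  - by rewrite conjMg; apply: DM.
  - by rewrite conjVg; apply: DV.
move=> z [u Nu [v Nv ->]] K [_ +]; apply; exists (u ^ y); first exact: nset_conj.
by exists (v ^ y); [exact: nset_conj|rewrite conjRg].
Qed.

Definition derived (N : normalSubgroup) : normalSubgroup :=
  NormalSubgroup (derived_subgroup N) (@derived_conj N).

End Subgroups.

Section Quotient.
Variables (G : groupType) (N : normalSubgroup G).

Definition coset_rel : rel G := fun x y => `[< nset N (x^-1 * y) >].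

Lemma coset_rel_equiv : equiv_class_of coset_rel.
Proof.
have [N1 NM NV] := nset_subgroup N.
split=> [x|x y|y x z].
- by apply/asboolP; rewrite mulVg.
- by apply/asboolP/asboolP => /NV; rewrite invgM invgK.
- move=> /asboolP Nxy /asboolP Nyz; apply/asboolP.
  by have := NM _ _ Nxy Nyz; rewrite -mulgA mulVKg.
Qed.

Canonical coset_rel_equiv_rel := EquivRelPack coset_rel_equiv.

Definition quot : Type := {eq_quot coset_rel}.
HB.instance Definition _ := Choice.on quot.
HB.instance Definition _ := EqQuotient.on quot.

Definition proj (x : G) : quot := \pi_quot x.

Lemma projP x y : proj x = proj y <-> nset N (x^-1 * y).
Proof.
by split=> [/eqmodP/asboolP//|Nxy]; apply/eqmodP; apply/asboolP.
Qed.

Definition quot_one : quot := proj 1.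
Definition quot_mul (a b : quot) : quot := proj (repr a * repr b).
Definition quot_inv (a : quot) : quot := proj (repr a)^-1.

Lemma proj_repr (a : quot) : proj (repr a) = a.
Proof. exact: reprK. Qed.

Lemma repr_proj x : nset N (x^-1 * repr (proj x)).
Proof. by apply/projP; rewrite proj_repr. Qed.

Lemma quot_mulE x y : quot_mul (proj x) (proj y) = proj (x * y).
Proof.
apply/esym/projP; have [N1 NM NV] := nset_subgroup N.
have := NM _ _ (nset_conj y (repr_proj x)) (repr_proj y).
by rewrite conjgE invgM !mulgA mulgK.
Qed.

Lemma quot_invE x : quot_inv (proj x) = proj x^-1.
Proof.
apply/esym/projP; have [N1 NM NV] := nset_subgroup N.
have := nset_conj x^-1 (NV _ (repr_proj x)).
by rewrite conjgE invgM !invgK !mulgA mulgK.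
Qed.

Lemma quot_mulA : associative quot_mul.
Proof.
move=> a b c; rewrite -(proj_repr a) -(proj_repr b) -(proj_repr c).
by rewrite !quot_mulE mulgA.
Qed.
Lemma quot_mul1 : left_id quot_one quot_mul.
Proof. by move=> a; rewrite -(proj_repr a) quot_mulE mul1g. Qed.
Lemma quot_mulr1 : right_id quot_one quot_mul.
Proof. by move=> a; rewrite -(proj_repr a) quot_mulE mulg1. Qed.
Lemma quot_mulV : left_inverse quot_one quot_inv quot_mul.
Proof. by move=> a; rewrite -(proj_repr a) quot_invE quot_mulE mulVg. Qed.
Lemma quot_mulrV : right_inverse quot_one quot_inv quot_mul.
Proof. by move=> a; rewrite -(proj_repr a) quot_invE quot_mulE mulgV. Qed.

HB.instance Definition _ :=
  isGroup.Build quot quot_mulA quot_mul1 quot_mulr1 quot_mulV quot_mulrV.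

Lemma projM : {morph proj : x y / x * y}.
Proof. by move=> x y; rewrite -quot_mulE. Qed.
Lemma proj1 : proj 1 = 1. Proof. by []. Qed.
Lemma projV : {morph proj : x / x^-1}.
Proof. by move=> x; rewrite -quot_invE. Qed.

End Quotient.

(* The letter (i, b) stands for x_i if b = false and for x_i^-1 if b = true. *)
Definition letter (I : Type) : Type := (I * bool)%type.
Definition linv (I : Type) (l : letter I) : letter I := (l.1, ~~ l.2).

Section Words.
Variables (I : Type) (G : groupType) (x : I -> G).

Definition eval_letter (l : letter I) : G := if l.2 then (x l.1)^-1 else x l.1.
Definition eval_word (w : seq (letter I)) : G := \prod_(l <- w) eval_letter l.

Definition has_wlength (g : G) (n : nat) : Prop :=
  exists2 w, size w = n & eval_word w = g.

(* The value 0 for elements outside the subgroup generated by x is never used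
   here: see quot_gen_generates and wreath_gen_generates. *)
Definition wlength (g : G) : nat :=
  if pselect (exists n, `[< has_wlength g n >]) is left e then ex_minn e else 0%N.

Definition generates : Prop := forall g : G, exists w, eval_word w = g.

Lemma wlengthP : generates -> forall g,
  has_wlength g (wlength g) /\
  forall w, eval_word w = g -> (wlength g <= size w)%N.
Proof.
move=> xG g; rewrite /wlength; case: pselect => [e|[]]; last first.
  by have [w wg] := xG g; exists (size w); apply/asboolP; exists w.
case: ex_minnP => n /asboolP gn min_n; split=> // w wg.
by apply: min_n; apply/asboolP; exists w.
Qed.

Lemma eval_cat u v : eval_word (u ++ v) = eval_word u * eval_word v.
Proof. by rewrite /eval_word big_cat. Qed.
Lemma eval_cons l v : eval_word (l :: v) = eval_letter l * eval_word v.
Proof. by rewrite /eval_word big_cons. Qed.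
Lemma eval_nil : eval_word [::] = 1.
Proof. by rewrite /eval_word big_nil. Qed.
Lemma eval_letterV l : eval_letter (linv l) = (eval_letter l)^-1.
Proof. by case: l => i [] /=; rewrite /eval_letter /= ?invgK. Qed.

End Words.

(* The free group on I, realised as the reduced words over the letters of I. *)
Section FreeGroup.
Variable I : choiceType.
Implicit Types (l m : letter I) (u v w : seq (letter I)).

Definition reduced w : bool := sorted (fun l m => m != linv l) w.

Definition push l w : seq (letter I) :=
  if w is m :: w' then if m == linv l then w' else l :: w else [:: l].

Definition reduce w : seq (letter I) := foldr push [::] w.

Definition winv w : seq (letter I) := rev (map (@linv I) w).

Lemma linvK : involutive (@linv I).
Proof. by case=> i b; rewrite /linv /= negbK. Qed.

Lemma push_reduced l w : reduced w -> reduced (push l w).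
Proof.
case: w => //= m w; case: ifP => [_|/negbT ml] /=; last by rewrite ml.
by rewrite /reduced; case: w => //= a b /andP[].
Qed.

Lemma foldr_reduced v w : reduced v -> reduced (foldr push v w).
Proof. by move=> vr; elim: w => //= l w; apply: push_reduced. Qed.

Lemma reduce_reduced w : reduced (reduce w).
Proof. exact: foldr_reduced. Qed.

Lemma pushK l w : reduced w -> push l (push (linv l) w) = w.
Proof.
case: w => [|m w] /=; first by rewrite eqxx.
rewrite linvK; case: eqVneq => [->|ml]; last by rewrite /= eqxx.
by case: w => //= a b /andP[/negbTE ->].
Qed.

Lemma reduce_id w : reduced w -> reduce w = w.
Proof.
elim: w => //= l w IHw lw; have wr : reduced w by case: w lw {IHw} => //= a b /andP[].
rewrite IHw //; case: w lw {IHw wr} => //= a b /andP[/negbTE ->] //.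
Qed.

Lemma foldr_reduce v u : reduced v -> foldr push v (reduce u) = foldr push v u.
Proof.
move=> vr; elim: u => //= l u <-; case: (reduce u) => //= m w.
by case: eqVneq => // ->; rewrite pushK // foldr_reduced.
Qed.

Lemma reduce_catl u v : reduce (reduce u ++ v) = reduce (u ++ v).
Proof. by rewrite /reduce !foldr_cat foldr_reduce // reduce_reduced. Qed.

Lemma reduce_catr u v : reduce (u ++ reduce v) = reduce (u ++ v).
Proof.
by rewrite /reduce !foldr_cat -!/(reduce _) (reduce_id (reduce_reduced v)).
Qed.

Lemma winvK : involutive winv.
Proof.
move=> w; rewrite /winv map_rev revK -map_comp -[RHS]map_id.
by apply: eq_map => l; rewrite /= linvK.
Qed.

Lemma winv_reduced w : reduced w -> reduced (winv w).
Proof.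
rewrite /reduced /winv rev_sorted sorted_map => H.
apply: sub_sorted H => l m /=.
by apply: contraNneq => ->; rewrite linvK.
Qed.

Lemma reduce_catV w : reduce (w ++ winv w) = [::].
Proof.
suff H v : reduced v -> foldr push v (w ++ winv w) = v by exact: H.
elim: w v => //= l w IHw v vr.
rewrite /winv /= rev_cons -rcons_cat -cats1 foldr_cat /=.
have pr := push_reduced (linv l) vr.
by rewrite IHw // pushK.
Qed.

Record freeGroup : Type := FreeGroup {
  fword :> seq (letter I);
  fword_reduced : reduced fword }.

HB.instance Definition _ := [isSub for fword].
HB.instance Definition _ := [Choice of freeGroup by <:].

Definition free_of_word w : freeGroup := FreeGroup (reduce_reduced w).
Definition free_one : freeGroup := @FreeGroup [::] isT.
Definition free_mul (g h : freeGroup) : freeGroup := free_of_word (g ++ h).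
Definition free_inv (g : freeGroup) : freeGroup :=
  FreeGroup (winv_reduced (fword_reduced g)).

Lemma free_mulA : associative free_mul.
Proof. by move=> f g h; apply: val_inj; rewrite /= reduce_catl reduce_catr catA. Qed.
Lemma free_mul1 : left_id free_one free_mul.
Proof. by move=> g; apply: val_inj; rewrite /= reduce_id // fword_reduced. Qed.
Lemma free_mulr1 : right_id free_one free_mul.
Proof. by move=> g; apply: val_inj; rewrite /= cats0 reduce_id // fword_reduced. Qed.
Lemma free_mulrV : right_inverse free_one free_inv free_mul.
Proof. by move=> g; apply: val_inj; rewrite /= reduce_catV. Qed.
Lemma free_mulV : left_inverse free_one free_inv free_mul.
Proof.
by move=> g; apply: val_inj; rewrite /= -{2}[fword g]winvK reduce_catV.
Qed.

HB.instance Definition _ :=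
  isGroup.Build freeGroup free_mulA free_mul1 free_mulr1 free_mulV free_mulrV.

Definition fgen (i : I) : freeGroup := @FreeGroup [:: (i, false)] isT.

Lemma free_of_word_cat u v : free_of_word (u ++ v) = free_of_word u * free_of_word v.
Proof. by apply: val_inj; rewrite /= reduce_catl reduce_catr. Qed.

Lemma eval_fgen w : eval_word fgen w = free_of_word w.
Proof.
elim: w => [|l w IHw]; first by rewrite eval_nil; apply: val_inj.
rewrite eval_cons IHw -cat1s free_of_word_cat; congr (_ * _).
by case: l => i []; apply: val_inj.
Qed.

Lemma fwordK (g : freeGroup) : free_of_word g = g.
Proof. by apply: val_inj; rewrite /= reduce_id // fword_reduced. Qed.

Lemma eval_fword (g : freeGroup) : eval_word fgen g = g.
Proof. by rewrite eval_fgen fwordK. Qed.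

Lemma fgen_generates : generates fgen.
Proof. by move=> g; exists g; rewrite eval_fword. Qed.

Section Lift.
Variables (G : groupType) (x : I -> G).

Definition free_lift (g : freeGroup) : G := eval_word x g.

Lemma eval_reduce w : eval_word x (reduce w) = eval_word x w.
Proof.
elim: w => //= l w IHw; rewrite eval_cons -IHw; case: (reduce w) => [|m v] /=.
  by rewrite eval_cons.
case: eqVneq => [->|_]; last by rewrite !eval_cons.
by rewrite eval_cons eval_letterV mulVKg.
Qed.

Lemma free_liftM : {morph free_lift : g h / g * h}.
Proof. by move=> g h; rewrite /free_lift /= eval_reduce eval_cat. Qed.

Lemma free_lift_gen i : free_lift (fgen i) = x i.
Proof. by rewrite /free_lift eval_cons eval_nil mulg1. Qed.

Lemma morph_eval (f : freeGroup -> G) :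
  {morph f : g h / g * h} -> (forall i, f (fgen i) = x i) ->
  forall w, f (eval_word fgen w) = eval_word x w.
Proof.
move=> fM fx; have f1 : f 1 = 1.
  by apply: (@mulgI _ (f 1)); rewrite -fM !mulg1.
have fV g : f g^-1 = (f g)^-1.
  by apply: (@mulgI _ (f g)); rewrite -fM !mulgV.
elim=> [|l w IHw]; first by rewrite !eval_nil.
by rewrite !eval_cons fM IHw; case: l => i []; rewrite /eval_letter /= ?fV fx.
Qed.

Lemma free_lift_unique (f : freeGroup -> G) :
  {morph f : g h / g * h} -> (forall i, f (fgen i) = x i) -> f =1 free_lift.
Proof. by move=> fM fx g; rewrite -[g in f g]eval_fword (morph_eval fM fx). Qed.

End Lift.
End FreeGroup.

Section FreeQuotient.
Variables (I : choiceType) (M : normalSubgroup (freeGroup I)).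

Definition quot_gen (i : I) : quot M := proj M (fgen i).

Lemma quot_gen_generates : generates quot_gen.
Proof.
move=> g; exists (repr g : freeGroup I); rewrite -[RHS]proj_repr.
by rewrite -[repr g in RHS]eval_fword (morph_eval (projM M) (fun=> erefl)).
Qed.
End FreeQuotient.

(* {malg V[K]} is the group of finitely supported functions K -> V, and
   << v *g k >> is the function with value v at k and 0 elsewhere; in
   particular {malg int[G]} is the additive group of Z[G]. *)
Section LinearExtension.
Local Open Scope ring_scope.
Variables (K L : choiceType) (V : zmodType).

Definition malg_map (f : K -> L) (g : {malg V[K]}) : {malg V[L]} :=
  \sum_(k <- msupp g) << g@_k *g f k >>.

Lemma malg_mapEw f (g : {malg V[K]}) (d : {fset K}) : (msupp g `<=` d)%fset ->
  malg_map f g = \sum_(k <- d) << g@_k *g f k >>.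
Proof.
move=> le_gd; apply: big_fset_incl => // k _ /mcoeff_outdom ->.
by rewrite monalgU0.
Qed.

Lemma malg_mapU f v k : malg_map f << v *g k >> = << v *g f k >>.
Proof. by rewrite (malg_mapEw _ msuppU_le) big_seq_fset1 mcoeffUU. Qed.

Lemma malg_map_is_additive f : additive (malg_map f).
Proof.
move=> g h; have := fsubsetUl (msupp g) (msupp h); have := fsubsetUr (msupp g) (msupp h).
move=> sh sg; rewrite (malg_mapEw _ sg) (malg_mapEw _ sh).
rewrite (malg_mapEw _ (msuppB_le g h)) -sumrB; apply: eq_bigr => k _.
by rewrite mcoeffB monalgUB.
Qed.
HB.instance Definition _ f :=
  GRing.isAdditive.Build {malg V[K]} {malg V[L]} (malg_map f) (malg_map_is_additive f).

End LinearExtension.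

Section MalgMapTheory.
Local Open Scope ring_scope.
Variables (V : zmodType).

Lemma eq_malg_map (K L : choiceType) (f f' : K -> L) (g : {malg V[K]}) :
  f =1 f' -> malg_map f g = malg_map f' g.
Proof. by move=> ff'; apply: eq_bigr => k _; rewrite ff'. Qed.

Lemma malg_mapD (K L : choiceType) (f : K -> L) (g h : {malg V[K]}) :
  malg_map f (g + h) = malg_map f g + malg_map f h.
Proof. exact: raddfD. Qed.

Lemma malg_map_id (K : choiceType) (g : {malg V[K]}) : malg_map id g = g.
Proof. by rewrite [RHS]monalgE. Qed.

Lemma malg_map_comp (K L M : choiceType) (f : L -> M) (h : K -> L) (g : {malg V[K]}) :
  malg_map f (malg_map h g) = malg_map (f \o h) g.
Proof.
rewrite [malg_map h g]/malg_map raddf_sum; apply: eq_bigr => k _.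
by rewrite /= malg_mapU.
Qed.

Lemma malg_map_can (K L : choiceType) (f : K -> L) (f' : L -> K)
    (g : {malg V[K]}) (y : L) :
  cancel f f' -> cancel f' f -> (malg_map f g)@_y = g@_(f' y).
Proof.
move=> fK f'K; rewrite {2}[g]monalgE !raddf_sum; apply: eq_bigr => k _ /=.
by rewrite !mcoeffU (can2_eq fK f'K).
Qed.
End MalgMapTheory.

(* The pair (b, f) stands for the element b f of B |x A^(B).  The group A is
   abelian and written additively, so that A^(B) is {malg A[B]}. *)
Section Wreath.
Variables (A : zmodType) (B : groupType).

Record wreath : Type := Wreath { wtop : B; wfun : {malg A[B]} }.

Definition wreath_pair (u : wreath) : B * {malg A[B]} := (wtop u, wfun u).
Definition pair_wreath (p : B * {malg A[B]}) : wreath := Wreath p.1 p.2.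
Lemma wreath_pairK : cancel wreath_pair pair_wreath. Proof. by case. Qed.
HB.instance Definition _ := Choice.copy wreath (can_type wreath_pairK).

Definition shift (b : B) (f : {malg A[B]}) : {malg A[B]} :=
  malg_map (fun x => x * b) f.

Lemma shiftE b f x : (shift b f)@_x = f@_(x * b^-1)%g.
Proof. by apply: (@malg_map_can _ _ _ (fun y => y * b) (fun y => y * b^-1)) => y; rewrite ?mulgK ?mulgVK. Qed.

Lemma shift_is_additive b : additive (shift b).
Proof. exact: malg_map_is_additive. Qed.
HB.instance Definition _ b :=
  GRing.isAdditive.Build {malg A[B]} {malg A[B]} (shift b) (shift_is_additive b).

Lemma shift1 f : shift 1 f = f.
Proof. by rewrite -[RHS]malg_map_id; apply: eq_malg_map => x; rewrite mulg1. Qed.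

Lemma shiftM b c f : shift (b * c) f = shift c (shift b f).
Proof. by rewrite /shift malg_map_comp; apply: eq_malg_map => x; rewrite /= mulgA. Qed.

Lemma shiftU b v k : shift b << v *g k >>%R = << v *g (k * b)%g >>%R.
Proof. exact: malg_mapU. Qed.

End Wreath.

(* Locked, so that unification does not unfold the group law. *)
HB.lock Definition wr_mul (A : zmodType) (B : groupType) (u v : wreath A B) :
    wreath A B :=
  Wreath (wtop u * wtop v) (shift (wtop v) (wfun u) + wfun v)%R.
HB.lock Definition wr_inv (A : zmodType) (B : groupType) (u : wreath A B) :
    wreath A B :=
  Wreath (wtop u)^-1 (- shift (wtop u)^-1 (wfun u))%R.

Section WreathGroup.
Variables (A : zmodType) (B : groupType).
Local Notation wreath := (wreath A B).

Definition wr_one : wreath := Wreath 1 0%R.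

Lemma wr_mulA : associative (@wr_mul A B).
Proof.
move=> [b f] [c g] [d h]; rewrite wr_mul.unlock /= mulgA; congr Wreath.
by rewrite raddfD /= -shiftM addrA.
Qed.
Lemma wr_mul1 : left_id wr_one (@wr_mul A B).
Proof. by case=> b f; rewrite wr_mul.unlock /= mul1g raddf0 add0r. Qed.
Lemma wr_mulr1 : right_id wr_one (@wr_mul A B).
Proof. by case=> b f; rewrite wr_mul.unlock /= mulg1 shift1 addr0. Qed.
Lemma wr_mulV : left_inverse wr_one (@wr_inv A B) (@wr_mul A B).
Proof.
case=> b f; rewrite wr_mul.unlock wr_inv.unlock /= mulVg; congr Wreath.
by rewrite raddfN /= -shiftM mulVg shift1 addNr.
Qed.
Lemma wr_mulrV : right_inverse wr_one (@wr_inv A B) (@wr_mul A B).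
Proof.
case=> b f; rewrite wr_mul.unlock wr_inv.unlock /= mulgV; congr Wreath.
by rewrite subrr.
Qed.

HB.instance Definition _ :=
  isGroup.Build wreath wr_mulA wr_mul1 wr_mulr1 wr_mulV wr_mulrV.

Lemma wr_mulE (u v : wreath) :
  u * v = Wreath (wtop u * wtop v) (shift (wtop v) (wfun u) + wfun v)%R.
Proof. by transitivity (wr_mul u v) => //; rewrite wr_mul.unlock. Qed.
Lemma wr_invE (u : wreath) :
  u^-1 = Wreath (wtop u)^-1 (- shift (wtop u)^-1 (wfun u))%R.
Proof. by transitivity (wr_inv u) => //; rewrite wr_inv.unlock. Qed.

Definition wr_top (b : B) : wreath := Wreath b 0%R.
Definition wr_fun (f : {malg A[B]}) : wreath := Wreath 1 f.
Definition wr_bot (a : A) : wreath := wr_fun << a *g 1%g >>%R.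

Lemma wr_topM : {morph wr_top : b c / b * c}.
Proof. by move=> b c; rewrite wr_mulE /= raddf0 addr0. Qed.
Lemma wr_funD : {morph wr_fun : f g / (f + g)%R >-> f * g}.
Proof. by move=> f g; rewrite wr_mulE /= mulg1 shift1. Qed.
Lemma wr_fun0 : wr_fun 0%R = 1. Proof. by []. Qed.
Lemma wr_botD : {morph wr_bot : a c / (a + c)%R >-> a * c}.
Proof. by move=> a c; rewrite /wr_bot monalgUD wr_funD. Qed.
Lemma wr_bot0 : wr_bot 0%R = 1.
Proof. by rewrite /wr_bot monalgU0. Qed.
Lemma wr_botN a : wr_bot (- a)%R = (wr_bot a)^-1.
Proof. by apply: (@mulgI _ (wr_bot a)); rewrite mulgV -wr_botD subrr wr_bot0. Qed.
Lemma wr_topV b : wr_top b^-1 = (wr_top b)^-1.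
Proof. by rewrite wr_invE /= raddf0 oppr0. Qed.
Lemma wreathE u : u = wr_top (wtop u) * wr_fun (wfun u).
Proof. by case: u => b f; rewrite wr_mulE /= mulg1 raddf0 add0r. Qed.
Lemma wr_fun_conj f b : wr_fun f ^ wr_top b = wr_fun (shift b f).
Proof.
by rewrite conjgE -wr_topV !wr_mulE /= mul1g mulVg !raddf0 !addr0 add0r.
Qed.

Definition wpow (a : A) (alpha : {malg int[B]}) : {malg A[B]} :=
  (\sum_(b <- msupp alpha) shift b << a *~ alpha@_b *g 1%g >>%R)%R.

Lemma wpowE a (alpha : {malg int[B]}) x : (wpow a alpha)@_x = (a *~ alpha@_x)%R.
Proof.
rewrite {2}[alpha]monalgE /wpow !raddf_sum /=; apply: eq_bigr => b _.
rewrite shiftU mul1g !mcoeffU; case: eqP => _; by rewrite ?mulr1n ?mulr0n ?mulr0z.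
Qed.

Lemma wpow0 a : wpow a 0%R = 0%R.
Proof. by apply/malgP => x; rewrite wpowE !mcoeff0 mulr0z. Qed.

Lemma wpowD a (al be : {malg int[B]}) :
  wpow a (al + be)%R = (wpow a al + wpow a be)%R.
Proof. by apply/malgP => x; rewrite mcoeffD !wpowE mcoeffD mulrzDr. Qed.

Lemma wpow_shift a (al : {malg int[B]}) b :
  wpow a (malg_map (fun x => x * b) al) = shift b (wpow a al).
Proof.
apply/malgP => x; rewrite wpowE shiftE wpowE; congr (_ *~ _)%R.
by apply: (@malg_map_can _ _ _ (fun y => y * b) (fun y => y * b^-1)) => y; rewrite ?mulgK ?mulgVK.
Qed.

Lemma wpowU a n b : wpow a << n *g b >>%R = << (a *~ n)%R *g b >>%R.
Proof.
apply/malgP => x; rewrite wpowE !mcoeffU.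
by case: eqP => _; rewrite ?mulr1n ?mulr0n ?mulr0z.
Qed.
End WreathGroup.

Section Fox.
Variable I : choiceType.
Local Notation F := (freeGroup I).
Local Notation x := (@fgen I).

Definition rmul (h : F) (alpha : {malg int[F]}) : {malg int[F]} :=
  malg_map (fun k => k * h) alpha.

(* The rule for x_j^-1 is forced by the product rule (foxM) applied to
   1 = x_j x_j^-1. *)
Definition fox_letter (i : I) (l : letter I) : {malg int[F]} :=
  if l.2 then << (- (l.1 == i)%:Z)%R *g ((x l.1)^-1)%g >>%R
  else << (l.1 == i)%:Z *g 1%g >>%R.

Fixpoint fox_word (i : I) (w : seq (letter I)) : {malg int[F]} :=
  if w is l :: w' then
    (rmul (eval_word x w') (fox_letter i l) + fox_word i w')%R
  else 0%R.

Definition fox (i : I) (g : F) : {malg int[F]} := fox_word i g.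

Lemma rmulM g h al : rmul (g * h) al = rmul h (rmul g al).
Proof. by rewrite /rmul malg_map_comp; apply: eq_malg_map => k; rewrite /= mulgA. Qed.

Lemma fox_word_cat i u v :
  fox_word i (u ++ v) = (rmul (eval_word x v) (fox_word i u) + fox_word i v)%R.
Proof.
elim: u => [|l u IHu] /=; first by rewrite /rmul raddf0 add0r.
by rewrite IHu eval_cat rmulM addrA {4}/rmul raddfD.
Qed.

Lemma fox_word_cancel i l w : fox_word i (l :: linv l :: w) = fox_word i w.
Proof.
rewrite /= addrA -[RHS]add0r; congr (_ + _)%R.
rewrite eval_cons eval_letterV rmulM; case: l => j [];
  rewrite /fox_letter /rmul /eval_letter /= !malg_mapU ?mulgV ?mulVg ?mul1g ?invgK;
  by rewrite -monalgUD ?addNr ?subrr monalgU0.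
Qed.

Lemma fox_word_reduce i w : fox_word i (reduce w) = fox_word i w.
Proof.
elim: w => //= l w <-; rewrite -eval_reduce; case: (reduce w) => //= m v.
by case: eqVneq => // ->; rewrite -[RHS]/(fox_word i [:: l, linv l & v]) fox_word_cancel.
Qed.

Lemma foxM i g h : fox i (g * h) = (rmul h (fox i g) + fox i h)%R.
Proof. by rewrite /fox /= fox_word_reduce fox_word_cat eval_fword. Qed.

Lemma fox_gen i j : fox i (x j) = << (j == i)%:Z *g 1%g >>%R.
Proof. by rewrite /fox /= addr0 eval_nil /rmul /fox_letter malg_mapU mulg1. Qed.
End Fox.

Section Magnus.
Variables (r : nat) (N : normalSubgroup (freeGroup 'I_r)).
Local Notation F := (freeGroup 'I_r).
Local Notation A := 'rV[int]_r.
Local Notation B := (quot N).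

(* A is the free abelian group 'rV[int]_r, written additively. *)
Definition abasis (i : 'I_r) : A := delta_mx 0%R i.

Definition wreath_gen (s : 'I_r + 'I_r) : wreath A B :=
  match s with
  | inl i => wr_top A (quot_gen N i)
  | inr i => wr_bot B (abasis i)
  end.

Definition magnus_free (g : F) : wreath A B :=
  wr_top A (proj N g) *
  \prod_(i < r) wr_fun (wpow (abasis i) (malg_map (proj N) (fox i g))).

(* This does not depend on the representative of w: see magnus_proj. *)
Definition magnus (w : quot (derived N)) : wreath A B := magnus_free (repr w).

Lemma magnus_freeE g : magnus_free g =
  Wreath (proj N g) (\sum_(i < r) wpow (abasis i) (malg_map (proj N) (fox i g)))%R.
Proof.
rewrite [RHS]wreathE; congr (_ * _) => /=.
by rewrite (big_morph _ (@wr_funD _ _) (@wr_fun0 _ _)).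
Qed.

Lemma magnus_freeM : {morph magnus_free : g h / g * h}.
Proof.
move=> g h; rewrite !magnus_freeE wr_mulE; congr Wreath; rewrite /= ?projM //.
rewrite raddf_sum -big_split /=; apply: eq_bigr => i _.
rewrite foxM malg_mapD.
rewrite wpowD.
apply: (congr1 (fun f => f + _)%R).
rewrite -wpow_shift.
apply: (congr1 (wpow _)).
rewrite /rmul 2!malg_map_comp.
by apply: eq_malg_map => k; rewrite /= projM.
Qed.

Lemma magnus_free1 : magnus_free 1 = 1.
Proof. by apply: (@mulgI _ (magnus_free 1)); rewrite -magnus_freeM !mulg1. Qed.

Lemma magnus_freeV : {morph magnus_free : g / g^-1}.
Proof.
by move=> g; apply: (@mulgI _ (magnus_free g)); rewrite -magnus_freeM !mulgV magnus_free1.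
Qed.

Lemma magnus_free_derived g : nset (derived N) g -> magnus_free g = 1.
Proof.
move: g; apply: (@smallest_sub _ _ _ [set g | magnus_free g = 1]).
  split=> [|g h|g] /=; first exact: magnus_free1.
  - by move=> g1 h1; rewrite magnus_freeM g1 h1 mulg1.
  - by move=> g1; rewrite magnus_freeV g1 invg1.
have NE g : nset N g -> exists f, magnus_free g = wr_fun f.
  move=> Ng; rewrite magnus_freeE; eexists; congr Wreath.
  by rewrite -(proj1 N); apply/projP; rewrite mulg1; have [_ _] := nset_subgroup N; apply.
move=> _ [g /NE[f gf] [h /NE[k hk] ->]] /=.
rewrite /commg /conjg !(magnus_freeM, magnus_freeV) gf hk.
have -> : wr_fun f * wr_fun k = wr_fun k * wr_fun f.
  by rewrite -wr_funD -[RHS]wr_funD (GRing.addrC f k).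
by rewrite mulKg mulVg.
Qed.

Lemma magnus_proj g : magnus (proj (derived N) g) = magnus_free g.
Proof.
have ->: magnus (proj (derived N) g) =
    magnus_free (g * (g^-1 * repr (proj (derived N) g))) by rewrite mulVKg.
by rewrite magnus_freeM (magnus_free_derived (repr_proj _ _)) mulg1.
Qed.

Lemma magnusM : {morph magnus : u v / u * v}.
Proof.
move=> u v; rewrite -(proj_repr u) -(proj_repr v) -projM !magnus_proj.
exact: magnus_freeM.
Qed.

Lemma magnus_gen i :
  magnus (quot_gen (derived N) i) = wr_top A (quot_gen N i) * wr_bot B (abasis i).
Proof.
rewrite magnus_proj magnus_freeE [RHS]wr_mulE /= mulg1 raddf0 add0r; congr Wreath.
rewrite (bigD1 i) //= big1 ?addr0 => [|j ij].
  by rewrite fox_gen eqxx malg_mapU wpowU mulr1z.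
by rewrite fox_gen eq_sym (negbTE ij) monalgU0 raddf0 wpow0.
Qed.

Lemma wreath_gen_generates : generates wreath_gen.
Proof.
pose S (g : wreath A B) := exists w, eval_word wreath_gen w = g.
have S1 : S 1 by exists [::]; rewrite eval_nil.
have SM g h : S g -> S h -> S (g * h).
  by move=> [u <-] [v <-]; exists (u ++ v); rewrite eval_cat.
have SV g : S g -> S g^-1.
  move=> [w <-]; elim: w => [|l w IHw]; first by rewrite eval_nil invg1.
  rewrite eval_cons invgM; apply: SM => //; exists [:: linv l].
  by rewrite eval_cons eval_nil mulg1 eval_letterV.
have Sgen s : S (wreath_gen s).
  by exists [:: (s, false)]; rewrite eval_cons eval_nil mulg1.
have Stop b : S (wr_top A b).
  have [w <-] := @quot_gen_generates _ N b.
  elim: w => [|l w IHw]; first by rewrite eval_nil.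
  rewrite eval_cons wr_topM; apply: SM => //.
  by case: l => i []; rewrite /eval_letter /= ?wr_topV; [apply: SV|]; apply: (Sgen (inl i)).
have Sbot (a : A) : S (wr_bot B a).
  have Sn i (n : nat) : S (wr_bot B (abasis i *+ n)%R).
    elim: n => [|n IHn]; first by rewrite mulr0n wr_bot0.
    by rewrite mulrS wr_botD; apply: SM IHn; apply: (Sgen (inr i)).
  rewrite [a]row_sum_delta; elim/big_ind: _ => [||i _].
  - by rewrite wr_bot0.
  - by move=> u v Su Sv; rewrite wr_botD; apply: SM.
  rewrite -[a _ _]intz scaler_int -/(abasis i); case: (a _ _) => n; first exact: Sn.
  by rewrite NegzE mulrNz wr_botN; apply: SV; apply: Sn.
have Sfun (f : {malg A[B]}) : S (wr_fun f).
  rewrite [f]monalgE; apply: (big_ind (fun h => S (wr_fun h))) => [|g h Sg Sh|b _].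
  - exact: S1.
  - by rewrite wr_funD; apply: SM.
  have -> : << f@_b *g b >>%R = shift b << f@_b *g 1%g >>%R by rewrite shiftU mul1g.
  rewrite -wr_fun_conj conjgE; apply: (SM); first exact/SV/Stop.
  by apply: SM; [exact: Sbot|exact: Stop].
by move=> u; rewrite [u]wreathE; apply: SM; [exact: Stop|exact: Sfun].
Qed.
End Magnus.

(* Main.v *)
Require Import Defs.
From mathcomp Require Import all_boot all_order all_algebra.
From mathcomp.multinomials Require Import monalg.
From mathcomp Require Import zify.

(** The Magnus embedding turns word length into a problem about walks.  Read
    from right to left, a word in the generators is a walk in the left Cayley
    graph of B, starting at 1 and going from b to l b for each letter l.  Its
    image in the wreath product is the pair (end of the walk, net flow of the
    walk through the edges), where the edge from v to x_i v is coordinate i of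
    the function at v ([eval_wreath_word]).

    Upper bound: each x_i is sent to the product x_i a_i of two generators.

    Lower bound: a wreath word of length n with p letters x_i^+-1 and q letters
    a_i^+-1 contains a word t of length p in the x_i, and each a_i^+-1, read
    at the current position v of the walk t, deposits one directed unit on the
    edge v -- x_i v.  So the function component is the flow of a list E of q
    directed edges, each touching the walk t ([wreath_word_flow]).  When the
    wreath word represents the image of w, this flow is also that of a walk
    from 1 to its end b, so it satisfies Kirchhoff's law, and E can be
    traversed in the manner of Euler: a walk from 1 to b is extracted from
    E ([extract_path]), the detour t^-1 t, of length 2p and zero net flow, is
    inserted at 1 in order to reach every vertex of t, and the balanced
    remainder of E is spliced in as closed walks ([absorb_circulation]).  The
    result is a word of length q + 2p <= 2n with the same image as w.

    It equals w because the embedding is injective ([magnus_inj]).  Fix a lift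
    of B to F/N'.  A word is the telescoping product, over the edges of its
    walk, of elements of N/N' depending only on the edge, up to the lifts of
    the two ends ([eval_edge_elt]).  Since N/N' is abelian and reversed edges
    give inverse elements, a walk with zero flow contributes nothing.

    The resulting bounds, |w| / 2 <= |phi(w)| <= 2 |w|, are stronger than the
    stated ones. *)

Set Implicit Arguments.
Unset Strict Implicit.

Import GRing.Theory Num.Theory.
Local Open Scope ring_scope.

(** * Walks and flows in the left Cayley graph *)

Section CayleyGraph.
Variables (r : nat) (B : groupType) (x : 'I_r -> B).
Local Notation A := 'rV[int]_r.
Local Notation edge := (B * letter 'I_r)%type.
Implicit Types (e : edge) (E : seq edge) (w : seq (letter 'I_r)) (a b v : B).
Local Notation ev := (eval_word x).

(** An edge is recorded as (v, (i, s)) where v is always that end of the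
    unoriented edge v -- x_i v which x_i leaves, whatever the direction of travel s.  The flow
    of an edge is then supported at its first component, and reversal only
    flips s. *)
Definition src e : B := if e.2.2 then (x e.2.1 * e.1)%g else e.1.
Definition tgt e : B := if e.2.2 then e.1 else (x e.2.1 * e.1)%g.
Definition einv e : edge := (e.1, linv e.2).

(** The walk spelled by w from right to left: from a to ev w * a. *)
Fixpoint path_edges a w : seq edge :=
  if w is l :: w' then
    let b := (ev w' * a)%g in
    ((if l.2 then (x l.1)^-1 * b else b)%g, l) :: path_edges a w'
  else [::].

Definition edge_sign e : int := if e.2.2 then -1 else 1.

Definition edge_flow e : {malg A[B]} := << edge_sign e *: abasis e.2.1 *g e.1 >>.
Definition flow E : {malg A[B]} := \sum_(e <- E) edge_flow e.

(** Inflow minus outflow at v; x_i^-1 v is the tail of the i-edge entering v. *)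
Definition divergence (f : {malg A[B]}) v : int :=
  \sum_(i < r) (f@_((x i)^-1 * v)%g 0 i - f@_v 0 i).

Lemma eval_wordV w : ev (winv w) = (ev w)^-1%g.
Proof.
apply: (@mulIg _ (ev w)); rewrite mulVg -eval_cat -{2}[w]winvK -eval_reduce.
by rewrite reduce_catV eval_nil.
Qed.

Lemma flow_cons e E : flow (e :: E) = edge_flow e + flow E.
Proof. exact: big_cons. Qed.

Lemma flow_cat E1 E2 : flow (E1 ++ E2) = flow E1 + flow E2.
Proof. exact: big_cat. Qed.

Lemma perm_flow E1 E2 : perm_eq E1 E2 -> flow E1 = flow E2.
Proof. by move=> p; apply: perm_big. Qed.

Lemma path_edges_cat a u w :
  path_edges a (u ++ w) = path_edges (ev w * a)%g u ++ path_edges a w.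
Proof. by elim: u => //= l u ->; rewrite eval_cat -mulgA. Qed.

Lemma size_path_edges a w : size (path_edges a w) = size w.
Proof. by elim: w => //= l w ->. Qed.

Lemma edge_flow_coef e v i :
  (edge_flow e)@_v 0 i = edge_sign e *+ ((e.2.1 == i) && (e.1 == v)).
Proof.
rewrite /edge_flow mcoeffU; case: (e.1 == v); last by rewrite mulr0n mxE andbF.
rewrite mulr1n andbT /abasis !mxE eqxx /= eq_sym.
by case: (e.2.1 == i); rewrite /= ?mulr1 ?mulr0.
Qed.

Lemma flow_coef E v i :
  (flow E)@_v 0 i
  = \sum_(e <- E) edge_sign e *+ ((e.2.1 == i) && (e.1 == v)).
Proof.
rewrite /flow raddf_sum summxE; apply: eq_bigr => e _.
exact: edge_flow_coef.
Qed.

Lemma divergenceD f g v : divergence (f + g) v = divergence f v + divergence g v.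
Proof.
rewrite -big_split; apply: eq_bigr => i _ /=.
by rewrite !mcoeffD !mxE opprD addrACA.
Qed.

Lemma divergence0 v : divergence 0 v = 0.
Proof. by rewrite /divergence big1 // => i _; rewrite !mcoeff0 mxE. Qed.

Lemma divergence_edge e v :
  divergence (edge_flow e) v = (tgt e == v)%:R - (src e == v)%:R.
Proof.
rewrite /divergence (bigD1 e.2.1) //= big1 => [|i ie]; last first.
  by rewrite !edge_flow_coef eq_sym (negbTE ie).
rewrite addr0 !edge_flow_coef eqxx /= /tgt /src /edge_sign.
rewrite [e.1 == (_ * _)%g]eq_sym -(inj_eq (mulgI (x e.2.1))) mulVKg.
rewrite [v == _]eq_sym.
by case: e.2.2; case: (_ == v); case: (_ == v); rewrite /= ?mulr0n ?mulr1n.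
Qed.

Lemma divergence_flow E v : divergence (flow E) v
  = \sum_(e <- E) ((tgt e == v)%:R - (src e == v)%:R).
Proof.
elim: E => [|e E IHE]; first by rewrite /flow !big_nil divergence0.
by rewrite flow_cons divergenceD divergence_edge IHE big_cons.
Qed.

Lemma path_edges_head a l w : let e := head (a, l) (path_edges a (l :: w)) in
  src e = (ev w * a)%g /\ tgt e = (ev (l :: w) * a)%g.
Proof.
rewrite /src /tgt eval_cons /eval_letter /=.
by case: l.2; rewrite ?mulVKg -?mulgA.
Qed.

Lemma divergence_path a w v :
  divergence (flow (path_edges a w)) v = (ev w * a == v)%g%:R - (a == v)%:R.
Proof.
elim: w => [|l w IHw].
  by rewrite /flow big_nil divergence0 eval_nil mul1g subrr.
have [se te] := path_edges_head a l w.
rewrite /= in se te *.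
by rewrite flow_cons divergenceD divergence_edge se te IHw; lia.
Qed.

Lemma edge_path e a w : (ev w * a)%g = src e ->
  path_edges a (e.2 :: w) = e :: path_edges a w.
Proof.
rewrite /src /= => ->; congr cons.
by case: e => v [i []] /=; rewrite ?mulKg.
Qed.

(** As long as a differs from b, the net inflow at b is positive, so some edge
    of E ends at b: it is the last step of the path, and what is left of E has
    the divergence of a path from a to the source of that edge. *)
Lemma extract_path E a b :
  (forall v, divergence (flow E) v = (b == v)%:R - (a == v)%:R) ->
  exists w E', perm_eq E (path_edges a w ++ E') /\ (ev w * a)%g = b.
Proof.
have [n] := ubnP (size E); elim: n => // n IHn in E a b *; rewrite ltnS => En dE.
have [ab|ab] := eqVneq a b; first by exists [::], E; rewrite eval_nil mul1g.
have /hasP[e eE /eqP te] : has (fun e => tgt e == b) E.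
  apply/negbNE/negP => /hasPn tE; have := dE b.
  rewrite eqxx (negbTE ab) subr0 divergence_flow => s1.
  suff : (1 : int) <= 0 by [].
  rewrite -[1]s1 big_seq; apply: sumr_le0 => e /tE /negbTE ->.
  by rewrite sub0r oppr_le0 ler0n.
have pE := perm_to_rem eE.
have [||w [E' [pw wa]]] := IHn (rem e E) a (src e).
- by have := perm_size pE; rewrite /= => s; rewrite -ltnS -s ltnS.
- move=> v; have := dE v; rewrite (perm_flow pE) flow_cons divergenceD.
  by rewrite divergence_edge te; lia.
exists (e.2 :: w), E'; split.
  by rewrite edge_path // (perm_trans pE) //= perm_cons.
rewrite -te /tgt eval_cons -mulgA wa /src /eval_letter.
by case: e.2.2; rewrite ?mulKg.
Qed.

(** The vertices of the walk that starts at 1 are the values of the suffixes. *)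
Definition visits w v := exists u1 u2, w = u1 ++ u2 /\ ev u2 = v.

Lemma visits_catl u w v : visits w v -> visits (u ++ w) v.
Proof.
by move=> [u1 [u2 [-> <-]]]; exists (u ++ u1), u2; rewrite catA.
Qed.

(** Removing e from a balanced list leaves the divergence of a path from the
    target of e back to its source; e closes that path.  The direction of e
    decides whether it comes first or last in a loop based at e.1. *)
Lemma closed_path_through E e : e \in E ->
  (forall v, divergence (flow E) v = 0) ->
  exists w E', [/\ perm_eq E (path_edges e.1 w ++ E'), (0 < size w)%N & ev w = 1%g].
Proof.
move=> eE dE; have pE := perm_to_rem eE.
have dR v : divergence (flow (rem e E)) v = (src e == v)%:R - (tgt e == v)%:R.
  have := dE v; rewrite (perm_flow pE) flow_cons divergenceD divergence_edge.
  by lia.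
have [w [E' [pw wt]]] := extract_path dR.
have [e2|e2] := boolP e.2.2.
  have te : tgt e = e.1 by rewrite /tgt e2.
  rewrite te in pw wt; exists (e.2 :: w), E'; split => //.
    by rewrite edge_path // (perm_trans pE) //= perm_cons.
  apply: (@mulIg _ e.1); rewrite mul1g eval_cons -mulgA wt /src /eval_letter e2.
  by rewrite mulKg.
have se : src e = e.1 by rewrite /src (negbTE e2).
have et : (ev [:: e.2] * e.1)%g = tgt e.
  by rewrite eval_cons eval_nil mulg1 /eval_letter /tgt (negbTE e2).
exists (w ++ [:: e.2]), E'; split.
- rewrite path_edges_cat et edge_path ?eval_nil ?mul1g //=.
  by rewrite (perm_trans pE) // -catA perm_sym perm_catC /= perm_cons
     perm_catC perm_sym.
- by rewrite size_cat addn1.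
- by apply: (@mulIg _ e.1); rewrite mul1g eval_cat -mulgA et wt.
Qed.

(** The splicing step of Euler's theorem.  A loop of E based at a vertex of the
    walk is inserted there; inserting a loop loses no vertex of the walk, so
    the remaining edges, still balanced, keep touching it. *)
Lemma absorb_circulation E w :
  (forall v, divergence (flow E) v = 0) ->
  (forall e, e \in E -> visits w e.1) ->
  exists w', [/\ ev w' = ev w,
    flow (path_edges 1 w') = flow (path_edges 1 w) + flow E
    & size w' = (size w + size E)%N].
Proof.
have [n] := ubnP (size E); elim: n => // n IHn in E w *; rewrite ltnS => En dE vE.
case: E => [|e E0] in En dE vE *.
  by exists w; rewrite /flow big_nil addr0 addn0.
have [t [E' [pE t0 t1]]] := closed_path_through (mem_head e E0) dE.
have [u1 [u2 [defw u2e]]] := vE _ (mem_head e E0).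
move: (e :: E0) => E in En dE vE pE *.
have fE := perm_flow pE; rewrite flow_cat in fE.
have sE := perm_size pE; rewrite size_cat size_path_edges in sE.
have evw : ev (u1 ++ t ++ u2) = ev w by rewrite defw !eval_cat t1 mul1g.
have [||e' e'E|w' [w'w fw' sw']] := IHn E' (u1 ++ t ++ u2).
- by rewrite (leq_trans _ En) // sE -add1n leq_add2r.
- move=> v; have := dE v; rewrite fE divergenceD divergence_path t1 mul1g.
  by rewrite subrr add0r.
- have /vE[y1 [y2 [w12 y2e]]] : e' \in E by rewrite (perm_mem pE) mem_cat e'E orbT.
  rewrite w12 in defw.
  (* The visited vertex is a suffix of w lying to the left (first case) or to
     the right of the point where the loop t is inserted; t evaluates to 1. *)
  have [le|lt] := leqP (size y1) (size u1).
    exists y1, (drop (size y1) u1 ++ t ++ u2); split.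
      have : take (size y1) (y1 ++ y2) = take (size y1) (u1 ++ u2) by rewrite defw.
      rewrite take_size_cat // takel_cat // => y1E.
      by rewrite (catA y1) {1}y1E cat_take_drop.
    have : drop (size y1) (y1 ++ y2) = drop (size y1) (u1 ++ u2) by rewrite defw.
    rewrite drop_size_cat // drop_cat ltn_neqAle le andbT => dy.
    rewrite -y2e !eval_cat t1 mul1g -eval_cat dy.
    case: eqP => //= eqs; by rewrite eqs subnn drop0 drop_size.
  exists (u1 ++ t ++ take (size y1 - size u1) u2), y2; split=> //.
  have : drop (size y1) (y1 ++ y2) = drop (size y1) (u1 ++ u2) by rewrite defw.
  rewrite drop_size_cat // drop_cat ltnNge (ltnW lt) /= => ->.
  by rewrite -!catA cat_take_drop.
exists w'; split; first by rewrite w'w.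
  rewrite fw' fE defw !path_edges_cat !flow_cat !eval_cat t1 !mul1g mulg1 u2e.
  by rewrite [flow (path_edges e.1 t) + flow (path_edges 1 u2)]addrC !addrA.
by rewrite sw' sE defw !size_cat [(size t + size u2)%N]addnC !addnA.
Qed.

(** The unit that e puts on its edge must be cancelled by some edge of E on the
    same support and with the opposite sign, and only einv e is of this kind. *)
Lemma mem_einv E e : flow (e :: E) = 0 -> einv e \in E.
Proof.
move=> f0; apply/negbNE/negP => eE.
have := congr1 (fun f : {malg A[B]} => edge_sign e * f@_(e.1) 0 e.2.1) f0.
rewrite flow_coef big_cons !eqxx /= mcoeff0 mxE mulr0 mulr1n mulrDr => s0.
have s1 : edge_sign e * edge_sign e = 1 by rewrite /edge_sign; case: ifP.
rewrite s1 mulr_sumr in s0.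
suff : 0 <= \sum_(e' <- E)
   edge_sign e * (edge_sign e' *+ ((e'.2.1 == e.2.1) && (e'.1 == e.1))).
  by move: s0; lia.
rewrite big_seq; apply: sumr_ge0 => e' e'E.
case: eqP => [i_e|]; last by rewrite mulr0n mulr0.
case: eqP => [v_e|]; last by rewrite mulr0n mulr0.
rewrite mulr1n; case: (eqVneq e'.2.2 e.2.2) => [s|s].
  by rewrite {2}/edge_sign s -/(edge_sign e) s1.
case/negP: eE; suff -> : einv e = e' by [].
move: i_e v_e s; rewrite /einv /linv; case: e' {e'E} => v [i s] /= -> ->.
by case: s; case: e.2.2.
Qed.

(** A list with zero flow cancels in pairs e, einv e.  Commutation is assumed
    only for the values of c: in the application they lie in the abelian
    subgroup N/N' of the nonabelian group F/N'. *)
Lemma prod_zero_flow (G : groupType) (c : edge -> G) E :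
  (forall e e', commute (c e) (c e')) -> (forall e, c (einv e) = (c e)^-1)%g ->
  flow E = 0 -> (\prod_(e <- E) c e = 1)%g.
Proof.
move=> cC cV.
have prod_rem E0 e : e \in E0 ->
    (\prod_(e0 <- E0) c e0 = c e * \prod_(e0 <- rem e E0) c e0)%g.
  elim: E0 => //= e0 E0 IHE; rewrite inE big_cons.
  case: eqVneq => [->//|ne] /= /IHE ->; rewrite big_cons.
  by rewrite !mulgA (cC e0 e).
have [n] := ubnP (size E); elim: n => // n IHn in E *; rewrite ltnS => En.
case: E => [|e E] in En *; first by rewrite big_nil.
move=> f0; have eE := mem_einv f0.
rewrite big_cons (prod_rem _ _ eE) cV mulVKg; apply: IHn.
  by rewrite size_rem //; exact: leq_ltn_trans (leq_pred _) En.
move: f0; rewrite flow_cons (perm_flow (perm_to_rem eE)) flow_cons addrA.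
rewrite /edge_flow -monalgUD -scalerDl /edge_sign /=.
by case: e.2.2; rewrite /= ?addNr ?subrr scale0r monalgU0 add0r.
Qed.

(** The words in the images x_i a_i of the generators under the Magnus
    embedding record the end and the flow of the walk in B. *)
Lemma eval_wreath_word w :
  eval_word (fun i => wr_top A (x i) * wr_bot B (abasis i))%g w
  = Wreath (ev w) (flow (path_edges 1 w)).
Proof.
elim: w => [|l w IHw]; first by rewrite !eval_nil /flow big_nil.
rewrite !eval_cons IHw wr_mulE; congr Wreath => /=.
  by rewrite /eval_letter; case: l.2; rewrite ?wr_invE wr_mulE /= ?mulg1.
rewrite flow_cons; congr (_ + _); rewrite /eval_letter /edge_flow /edge_sign /=.
case: l.2; rewrite ?wr_invE wr_mulE /= mulg1 raddf0 add0r !shiftU mul1g.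
  by rewrite raddfN /= shiftU mulg1 scaleN1r monalgUN.
by rewrite scale1r.
Qed.
End CayleyGraph.

(** * Injectivity of the Magnus embedding *)

Section Magnus.
Variables (r : nat) (N : normalSubgroup (freeGroup 'I_r)).
Local Notation B := (quot N).
Local Notation Q := (quot (derived N)).
Local Notation x := (quot_gen N).
Local Notation X := (quot_gen (derived N)).
Local Open Scope group_scope.

Lemma proj_eval (M : normalSubgroup (freeGroup 'I_r)) w :
  proj M (eval_word (@fgen _) w) = eval_word (quot_gen M) w.
Proof. exact: (morph_eval (projM M) (fun=> erefl)). Qed.

Lemma magnus_eval w :
  magnus (eval_word X w) = Wreath (eval_word x w) (flow (path_edges x 1 w)).
Proof.
rewrite -eval_wreath_word -proj_eval magnus_proj.
apply: (morph_eval (@magnus_freeM _ N)) => i.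
by rewrite -magnus_proj magnus_gen.
Qed.

Lemma proj_derived_comm g h : nset N g -> nset N h ->
  commute (proj (derived N) g) (proj (derived N) h).
Proof.
move=> Ng Nh; rewrite /commute -!projM; apply/esym/projP.
have -> : ((h * g)^-1 * (g * h) = [~ g, h])%g.
  by rewrite /commg conjgE invgM !mulgA.
by move=> K [_]; apply; exists g => //; exists h.
Qed.

Definition lift (b : B) : Q := proj (derived N) (repr b).

(** The class in N/N' of the loop that goes to the source of the edge along
    the lift, crosses the edge, and returns to 1 along the lift. *)
Definition edge_elt (e : B * letter 'I_r) : Q :=
  let c := (lift (x e.2.1 * e.1))^-1 * X e.2.1 * lift e.1 in
  if e.2.2 then c^-1 else c.

Lemma edge_elt_comm e e' : commute (edge_elt e) (edge_elt e').
Proof.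
have edgeN e0 : exists2 g, nset N g & edge_elt e0 = proj (derived N) g.
  have [N1 _ NV] := nset_subgroup N.
  pose g := (repr (x e0.2.1 * e0.1))^-1 * fgen e0.2.1 * repr e0.1.
  have Ng : nset N g.
    rewrite /g -mulgA; apply/projP; rewrite proj_repr projM proj_repr.
    by [].
  rewrite /edge_elt; case: e0.2.2; last by exists g; rewrite // !projM projV.
  by exists g^-1; [exact: NV | rewrite projV !projM projV].
have [g Ng ->] := edgeN e; have [h Nh ->] := edgeN e'.
exact: proj_derived_comm.
Qed.

Lemma eval_edge_elt w : eval_word X w =
  lift (eval_word x w) * (\prod_(e <- path_edges x 1 w) edge_elt e) * (lift 1)^-1.
Proof.
elim: w => [|l w IHw]; first by rewrite !eval_nil big_nil mulg1 mulgV.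
rewrite !eval_cons big_cons IHw !mulg1 !mulgA; congr (_ * _ * _).
rewrite /edge_elt /eval_letter /=; case: l.2; last by rewrite !mulgA mulgV mul1g.
by rewrite mulVKg !invgM invgK !mulgA mulgV mul1g.
Qed.

Lemma magnus_inj : injective (@magnus r N).
Proof.
move=> u v uv; suff uv1 : u * v^-1 = 1 by rewrite -[u](mulgVK v) uv1 mul1g.
have : magnus (u * v^-1) = 1.
  by apply: (@mulIg _ (magnus v)); rewrite mul1g -magnusM mulgVK.
have [w <-] := @quot_gen_generates _ (derived N) (u * v^-1).
rewrite magnus_eval => -[ew fw].
rewrite eval_edge_elt ew (prod_zero_flow edge_elt_comm _ fw).
  by rewrite mulg1 mulgV.
by move=> e; rewrite /edge_elt /=; case: e.2.2; rewrite ?invgK.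
Qed.

(** * Length estimates *)

(** The letters x_i of z spell w and move the current vertex; a letter a_i
    acts at the current vertex, which is therefore visited by w. *)
Lemma wreath_word_flow z : exists w E,
  [/\ eval_word (@wreath_gen r N) z = Wreath (eval_word x w) (flow E),
      (size w + size E)%N = size z
    & forall e, e \in E -> visits x w e.1].
Proof.
elim: z => [|[[i|i] s] z [w [E [zE sz vE]]]].
- by exists [::], [::]; rewrite !eval_nil /flow big_nil.
- exists ((i, s) :: w), E; split; last by move=> e /vE; exact: (visits_catl [:: _]).
    rewrite !eval_cons zE /eval_letter /= wr_mulE.
    by case: s; rewrite ?wr_invE /= !raddf0 ?oppr0 ?raddf0 add0r.
  by rewrite /= -sz.
exists w, ((eval_word x w, (i, s)) :: E); split.
- rewrite eval_cons zE /eval_letter flow_cons wr_mulE /edge_flow /edge_sign /=.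
  case: s; rewrite ?wr_invE /= ?invg1 mul1g ?shift1 ?raddfN /= shiftU mul1g.
    by rewrite scaleN1r monalgUN.
  by rewrite scale1r.
- by rewrite /= addnS sz.
- move=> e; rewrite inE => /predU1P[->|/vE //].
  by exists [::], w.
Qed.

(** The letters x_i of a shortest wreath word are used twice (the detour
    t^-1 t), its letters a_i once. *)
Lemma wlength_magnus_lower w :
  (wlength X w <= 2 * wlength (@wreath_gen r N) (magnus w))%N.
Proof.
have [[z <- ez] _] := wlengthP (@wreath_gen_generates r N) (magnus w).
have [_ minw] := wlengthP (@quot_gen_generates _ (derived N)) w.
have [t [E [zE <- vE]]] := wreath_word_flow z.
have [u uw] := @quot_gen_generates _ (derived N) w.
have := ez; rewrite -{1}uw magnus_eval zE => -[tu fu].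
have [v|p [E' [pE pu]]] := @extract_path _ _ x E 1 (eval_word x u).
  by rewrite fu divergence_path mulg1.
rewrite mulg1 in pu.
(* The detour has the flow of the trivial word, namely zero. *)
have wt : eval_word x (winv t ++ t) = 1 by rewrite eval_cat eval_wordV mulVg.
have ft : flow (path_edges x 1 (winv t ++ t)) = 0%R.
  have := magnus_eval (winv t ++ t).
  rewrite eval_cat eval_wordV mulVg wt => ft.
  have m1 : magnus (1 : Q) = 1 by rewrite -(proj1 (derived N)) magnus_proj magnus_free1.
  by have := etrans (esym ft) m1 => -[].
have fE : (flow E = flow (path_edges x 1 p) + flow E')%R.
  by rewrite (perm_flow pE) flow_cat.
have [v|e e'|w' [ew' fw' sw']] := @absorb_circulation _ _ x E' (p ++ winv t ++ t).
- have := congr1 (fun f => divergence x f v) fE.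
  rewrite fu divergenceD !divergence_path pu => /esym /eqP.
  by rewrite -subr_eq0 addrAC subrr add0r => /eqP.
- rewrite catA; apply/visits_catl/vE.
  by rewrite (perm_mem pE) mem_cat e' orbT.
have -> : (2 * (size t + size E) = size w' + size E)%N.
  rewrite sw' !size_cat /winv size_rev size_map (perm_size pE).
  rewrite size_cat size_path_edges; move: (size t) (size p) (size E').
  by move=> *; lia.
apply: leq_trans (leq_addr _ _); apply: minw; apply: magnus_inj.
rewrite -ez zE magnus_eval ew' fw'.
rewrite eval_cat wt mulg1 pu tu; congr Wreath.
by rewrite fE path_edges_cat flow_cat wt mulg1 ft addr0.
Qed.

Lemma wlength_magnus_upper w :
  (wlength (@wreath_gen r N) (magnus w) <= 2 * wlength X w)%N.
Proof.
have [[u <- uw] _] := wlengthP (@quot_gen_generates _ (derived N)) w.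
have [_ minz] := wlengthP (@wreath_gen_generates r N) (magnus w).
pose dbl (l : letter 'I_r) : seq (letter ('I_r + 'I_r)) :=
  if l.2 then [:: (inr l.1, true); (inl l.1, true)]
  else [:: (inl l.1, false); (inr l.1, false)].
have -> : (2 * size u = size (flatten (map dbl u)))%N.
  rewrite size_flatten /shape -map_comp mulnC.
  elim: (u) => //= -[i []] u0 /=; rewrite mulSn => -> //.
apply: minz; rewrite -uw magnus_eval -eval_wreath_word.
elim: (u) => [|[i s] u0 IHu]; first by rewrite !eval_nil.
rewrite /= eval_cat eval_cons -IHu; congr (_ * _).
rewrite /dbl /eval_letter; case: s => /=.
  by rewrite !eval_cons eval_nil mulg1 /eval_letter /= invgM.
by rewrite !eval_cons eval_nil mulg1.
Qed.
End Magnus.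

Theorem theorem1 (r : nat) (hr : (1 <= r)%N)
    (N : normalSubgroup (freeGroup 'I_r)) (w : quot (derived N)) :
  (2 * (r%:R + 1))^-1 * (wlength (quot_gen (derived N)) w)%:R
     <= (wlength (@wreath_gen r N) (magnus w))%:R :> rat
  /\ (wlength (@wreath_gen r N) (magnus w))%:R
     <= 3 * (wlength (quot_gen (derived N)) w)%:R :> rat.
Proof.
have lo := wlength_magnus_lower w; have up := wlength_magnus_upper w.
split; last first.
  rewrite -natrM ler_nat (leq_trans up) //.
  by rewrite leq_mul2r orbT.
rewrite natr1 -natrM mulrC ler_pdivrMr ?ltr0n // -natrM.
rewrite ler_nat (leq_trans lo) // mulnC leq_mul2l.
by rewrite leq_pmulr ?orbT.
Qed.
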